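(* Let $G$ be a graph, $r \in V(G)$, and $S \subseteq V(G)$ with $r \notin S$. If the bilevel integer linear program $PI_S(G,r)$ is infeasible, then $\pi_S(G,r) \le |V(G)|$. Otherwise, the optimal objective value of $PI_S(G,r)$ is exactly $\pi_S(G,r) - 1$.
   Context: All graphs are simple and connected. A pebbling configuration on $G$ is a map $p: V(G)\to\mathbb{Z}_{\ge 0}$ with size $|p|=\sum_v p(v)$ and support $\{v: p(v)>0\}$. A pebbling move removes two pebbles from one vertex and places one on an adjacent vertex; $p$ is $r$-solvable if some sequence of moves yields a configuration with at least one pebble on $r$. $\pi_S(G,r)$ is the least $m$ such that every configuration of size $m$ with support contained in $S$ is $r$-solvable. The arc set is $A(G)=\{(u,v): \{u,v\}\in E(G)\}$; $\delta^-(v)$ is the set of arcs $(u,v)$ into $v$ and $\delta^+(v)$ the set of arcs $(v,u)$ out of $v$. For a configuration $p$, $SOL_p(G,r)$ is the integer program in variables $z_a\in\mathbb{Z}_{\ge0}$ ($a\in A(G)$): maximize $\sum_{a\in\delta^-(r)} z_a$ subject to $\sum_{a\in\delta^+(v)} 2z_a \le p(v)+\sum_{a\in\delta^-(v)} z_a$ for all $v$, and $\sum_{a\in\delta^+(r)} z_a\le 0$. The bilevel program $PI_S(G,r)$ (in the optimistic sense: the leader chooses upper-level variables, and among the follower's optimal responses the one best for the leader is taken) has upper-level variables $y_v\in\mathbb{Z}_{\ge0}$ for $v\in S$ and lower-level variables $x\in\mathbb{Z}_{\ge 0}^{A(G)}$: maximize $\sum_{v\in S} y_v$ subject to $\sum_{v\in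 S} y_v \ge |V(G)|$, $x$ is an optimal solution of $SOL_{p_y}(G,r)$ where $p_y(v)=y_v$ for $v\in S$ and $p_y(v)=0$ otherwise, and $\sum_{a\in\delta^-(r)} x_a \le 0$. A feasible solution is a pair $(x,y)$ satisfying all these constraints; the program is infeasible if none exists, and its optimal objective value is the maximum of $\sum_{v\in S} y_v$ over feasible solutions. *)

(* Defs.v *)
From mathcomp Require Import all_boot.
From mathcomp Require Import boolp.

Set Implicit Arguments.
Unset Strict Implicit.
Unset Printing Implicit Defensive.

Record graph := Graph {
  vertex :> finType;
  edge : rel vertex;
  edge_sym : symmetric edge;
  edge_irr : irreflexive edge;
  edge_conn : forall u v, connect edge u v
}.

Definition arc (G : graph) := {a : G * G | edge a.1 a.2}.

Definition arc_tail (G : graph) (a : arc G) : G := (val a).1.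
Definition arc_head (G : graph) (a : arc G) : G := (val a).2.

Definition arcs_in (G : graph) (v : G) : {set arc G} := [set a | arc_head a == v].
Definition arcs_out (G : graph) (v : G) : {set arc G} := [set a | arc_tail a == v].

Definition config (G : graph) := {ffun G -> nat}.

Definition config_size (G : graph) (p : config G) : nat := \sum_v p v.

Definition config_supp (G : graph) (p : config G) : {set G} :=
  [set v | 0 < p v].

(* Truncation in the subtraction is harmless: [pebbling_move] requires at
   least two pebbles on [arc_tail a], and [arc_tail a != arc_head a]. *)
Definition apply_move (G : graph) (p : config G) (a : arc G) : config G :=
  [ffun v => p v - 2 * (v == arc_tail a) + (v == arc_head a)].

Definition pebbling_move (G : graph) : rel (config G) :=
  fun p q => [exists a : arc G, (2 <= p (arc_tail a)) && (q == apply_move p a)].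

Definition solvable (G : graph) (r : G) (p : config G) : Prop :=
  exists2 s : seq (config G), path (@pebbling_move G) p s & 0 < last p s r.

Definition all_solvable (G : graph) (S : {set G}) (r : G) (m : nat) : Prop :=
  forall p : config G,
    config_size p = m -> config_supp p \subset S -> solvable r p.

Lemma solvable_ge1 (G : graph) (r : G) (p : config G) :
  0 < p r -> solvable r p.
Proof. by exists [::]. Qed.

Lemma solvable_step (G : graph) (r : G) (p : config G) (a : arc G) :
  2 <= p (arc_tail a) -> solvable r (apply_move p a) -> solvable r p.
Proof.
move=> pa [s ps sr]; exists (apply_move p a :: s) => //=.
by rewrite ps andbT; apply/existsP; exists a; rewrite pa eqxx.
Qed.

Lemma solvable_push (G : graph) (r u v : G) (n k : nat) (p : config G) :
  edge u v -> (forall q : config G, n <= q v -> solvable r q) ->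
  2 * k <= p u -> n <= p v + k -> solvable r p.
Proof.
move=> uv nv; have vNu : v != u.
  by apply: contraTneq uv => ->; rewrite edge_irr.
elim: k p => [|k IHk] p pu pv; first by apply: nv; rewrite addn0 in pv.
rewrite mulnS in pu; pose a : arc G := exist _ (u, v) uv.
apply: (@solvable_step _ _ _ a).
  by rewrite /arc_tail /=; apply: leq_trans pu; rewrite leq_addr.
apply: IHk; rewrite ffunE /arc_tail /arc_head /= eqxx ?(negPf vNu) ?[u == v]eq_sym ?(negPf vNu).
  by rewrite muln1 addn0 leq_subRL // (leq_trans _ pu) // leq_addr.
by rewrite muln0 subn0 -addnA add1n.
Qed.

Lemma solvable_path (G : graph) (u : G) (s : seq G) (p : config G) :
  path (@edge G) u s -> 2 ^ size s <= p u -> solvable (last u s) p.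
Proof.
elim: s u p => [|v s IHs] u p /=; first by move=> _; apply: solvable_ge1.
case/andP=> uv vs pu; apply: (@solvable_push _ _ u v (2 ^ size s) (2 ^ size s)) => //.
- by move=> q; apply: IHs.
- by rewrite -expnS.
- exact: leq_addl.
Qed.

Lemma ex_all_solvable (G : graph) (S : {set G}) (r : G) :
  exists m, `[< all_solvable S r m >].
Proof.
exists (#|G| * 2 ^ #|G|).+1; apply/asboolP => p sz_p _.
have [/existsP[u pu]|] := boolP [exists u, 2 ^ #|G| <= p u]; last first.
  rewrite negb_exists => /forallP small.
  suff: config_size p <= #|G| * 2 ^ #|G| by rewrite sz_p ltnn.
  rewrite -sum_nat_const; apply: leq_sum => v _.
  by apply: ltnW; rewrite ltnNge small.
have /connectP[s us ->] := edge_conn u r.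
case/shortenP: us => t ut uniq_t _; apply: solvable_path => //.
apply: leq_trans pu; rewrite leq_exp2l //.
by move/andP: uniq_t => [_ /card_uniqP <-]; apply: max_card.
Qed.

(* [ex_minn] needs a boolean predicate, hence the classical [`[< _ >]]; the
   minimum is over a set that is nonempty because [G] is connected. *)
Definition pebbling_number (G : graph) (S : {set G}) (r : G) : nat :=
  ex_minn (ex_all_solvable S r).

(* The empty configuration is unsolvable, so [pebbling_number S r - 1] is never
   a truncated difference. *)
Lemma pebbling_number_gt0 (G : graph) (S : {set G}) (r : G) :
  0 < pebbling_number S r.
Proof.
rewrite /pebbling_number; case: ex_minnP => -[|//] /asboolP sol0 _.
have [||[|q s] /=] := sol0 [ffun => 0].
- by rewrite /config_size big1 // => v _; rewrite ffunE.
- by apply/subsetP => v; rewrite inE ffunE.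
- by rewrite ffunE.
- by case/andP=> /existsP[a]; rewrite ffunE.
Qed.

Definition arc_vars (G : graph) := {ffun arc G -> nat}.

Definition SOL_obj (G : graph) (r : G) (z : arc_vars G) : nat :=
  \sum_(a in arcs_in r) z a.

Definition SOL_feasible (G : graph) (p : config G) (r : G) (z : arc_vars G) :
    Prop :=
  (forall v : G, \sum_(a in arcs_out v) 2 * z a
                   <= p v + \sum_(a in arcs_in v) z a)
  /\ \sum_(a in arcs_out r) z a <= 0.

Definition SOL_optimal (G : graph) (p : config G) (r : G) (z : arc_vars G) :
    Prop :=
  SOL_feasible p r z /\
  forall z' : arc_vars G, SOL_feasible p r z' -> SOL_obj r z' <= SOL_obj r z.

Definition supp_vars (G : graph) (S : {set G}) :=
  {ffun {v : G | v \in S} -> nat}.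

Definition config_of (G : graph) (S : {set G}) (y : supp_vars S) : config G :=
  [ffun v => if insub v is Some w then y w else 0].

Definition PI_obj (G : graph) (S : {set G}) (y : supp_vars S) : nat :=
  \sum_w y w.

(* Optimistic reading: [x] may be any optimal solution of the follower's
   program, and is chosen together with [y]. *)
Definition PI_feasible (G : graph) (S : {set G}) (r : G)
    (x : arc_vars G) (y : supp_vars S) : Prop :=
  [/\ #|G| <= PI_obj y,
      SOL_optimal (config_of y) r x
    & \sum_(a in arcs_in r) x a <= 0].

Definition PI_infeasible (G : graph) (S : {set G}) (r : G) : Prop :=
  ~ exists (x : arc_vars G) (y : supp_vars S), PI_feasible r x y.

Definition PI_optimal_value (G : graph) (S : {set G}) (r : G) (N : nat) :
    Prop :=
  (exists (x : arc_vars G) (y : supp_vars S),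
      PI_feasible r x y /\ PI_obj y = N)
  /\ forall (x : arc_vars G) (y : supp_vars S),
      PI_feasible r x y -> PI_obj y <= N.

(* Main.v *)
Require Import Defs.
From mathcomp Require Import all_boot.
From mathcomp Require Import boolp zify.

Set Implicit Arguments.
Unset Strict Implicit.
Unset Printing Implicit Defensive.

(** For a configuration with no pebble on [r], being [r]-solvable is the same
    as the integer program having a feasible point of positive value. Counting
    the moves of a solution gives such a point. Conversely, a feasible point is
    executed move by move; if no remaining move can be executed then every
    vertex with positive outflow holds at most one pebble, hence its outflow is
    at most its inflow, and summing over all vertices shows that nothing
    flows into [r]. *)

Lemma leq_SOL_feasible (G : graph) (p q : config G) (r : G)
    (z : arc_vars G) :
  (forall v, p v <= q v) -> SOL_feasible p r z -> SOL_feasible q r z.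
Proof.
move=> pq [pz rz]; split=> // v; apply: leq_trans (pz v) _.
by rewrite leq_add2r.
Qed.

Definition add_arc (G : graph) (z : arc_vars G) (a : Defs.arc G) : arc_vars G :=
  [ffun b => z b + (b == a)].

Lemma sum_add_arc (G : graph) (z : arc_vars G) (a : Defs.arc G)
    (A : {set Defs.arc G}) :
  \sum_(b in A) add_arc z a b = \sum_(b in A) z b + (a \in A).
Proof.
under eq_bigr do rewrite ffunE.
rewrite big_split /=; congr (_ + _); have [aA|aNA] := boolP (a \in A).
  rewrite (bigD1 a) //= eqxx big1 // => b /andP[_ /negPf ->] //.
by rewrite big1 // => b bA; case: eqP bA aNA => // -> ->.
Qed.

(** Making the move along [a] takes 2 from the budget of its tail and adds 1 at its head, exactly
    what one more unit of flow on [a] does to the constraints. The bound on [p] makes the truncated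
    subtraction exact; a tail other than [r] keeps the constraint on [r]. *)
Lemma SOL_feasible_add_arc (G : graph) (p : config G) (r : G)
    (z : arc_vars G) (a : Defs.arc G) :
    2 <= p (arc_tail a) -> arc_tail a != r ->
  SOL_feasible (apply_move p a) r z <-> SOL_feasible p r (add_arc z a).
Proof.
move=> pa ar; rewrite /SOL_feasible sum_add_arc inE (negPf ar) addn0.
have flow v : (\sum_(b in arcs_out v) 2 * z b
                 <= apply_move p a v + \sum_(b in arcs_in v) z b)
    = (\sum_(b in arcs_out v) 2 * add_arc z a b
                 <= p v + \sum_(b in arcs_in v) add_arc z a b).
  rewrite -!big_distrr /= !sum_add_arc !inE ffunE ![v == _]eq_sym.
  case: (arc_tail a =P v) pa => [->|_] pa /=; first by lia.
  by rewrite muln0 subn0 addn0 addnAC addnA.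
by split=> -[fz rz]; split=> // v; rewrite ?flow // -flow.
Qed.

Lemma solvable_SOL_feasible (G : graph) (r : G) (p : config G) :
  p r = 0 -> solvable r p -> exists2 z, SOL_feasible p r z & 0 < SOL_obj r z.
Proof.
move=> pr0 [s ps sr]; elim: s p pr0 ps sr => [|q s IHs] p pr0 /=.
  by rewrite pr0.
case/andP=> /existsP[a /andP[pa /eqP ->]] {q} qs sr.
have ar : arc_tail a != r by apply: contraTneq pa => ->; rewrite pr0.
(* Counting stops at the first move into [r], because later moves might leave [r], which the program
   forbids. *)
have [qr0|qr_gt0] := posnP (apply_move p a r).
  have [z fz z_gt0] := IHs _ qr0 qs sr.
  exists (add_arc z a); first exact/SOL_feasible_add_arc.
  by rewrite /SOL_obj sum_add_arc ltn_addr.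
exists (add_arc [ffun=> 0] a).
  apply/SOL_feasible_add_arc => //; split=> [v|].
    by rewrite big1 // => b _; rewrite ffunE.
  by rewrite big1 // => b _; rewrite ffunE.
rewrite /SOL_obj sum_add_arc inE.
move: qr_gt0; rewrite ffunE pr0 [r == arc_head a]eq_sym sub0n add0n.
by move=> /ltn_addl->.
Qed.

Lemma sum_arcs_out (G : graph) (z : arc_vars G) :
  \sum_v \sum_(a in arcs_out v) z a = \sum_a z a.
Proof.
rewrite (partition_big (@arc_tail G) xpredT) //=.
by apply: eq_bigr => v _; apply: eq_bigl => a; rewrite inE.
Qed.

Lemma sum_arcs_in (G : graph) (z : arc_vars G) :
  \sum_v \sum_(a in arcs_in v) z a = \sum_a z a.
Proof.
rewrite (partition_big (@arc_head G) xpredT) //=.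
by apply: eq_bigr => v _; apply: eq_bigl => a; rewrite inE.
Qed.

Lemma SOL_feasible_executable (G : graph) (p : config G) (r : G)
    (z : arc_vars G) :
  SOL_feasible p r z -> 0 < SOL_obj r z ->
  exists2 a, 0 < z a & 2 <= p (arc_tail a).
Proof.
move=> [fz rz] z_gt0.
have [/existsP[a /andP[za pa]]|] :=
  boolP [exists a, (0 < z a) && (1 < p (arc_tail a))]; first by exists a.
rewrite negb_exists => /forallP stuck.
(* At [r] the outflow is 0 and the inflow is the objective, so the extra term survives when both
   sides are summed to the total flow. *)
have flow v : \sum_(a in arcs_out v) z a + (v == r) * SOL_obj r z
                <= \sum_(a in arcs_in v) z a.
  have [->|_] := eqVneq v r; first by rewrite mul1n /SOL_obj; lia.
  rewrite mul0n addn0; have := fz v; rewrite -big_distrr /=.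
  (* A positive outflow [o] forces [p v <= 1], so [2 * o <= 1 + inflow] and [o >= 1] give
     [o <= inflow]. *)
  have [->//|] := posnP (\sum_(a in arcs_out v) z a).
  rewrite lt0n sum_nat_eq0 => /forallPn[a]; rewrite negb_imply inE -lt0n.
  by case/andP=> /eqP <- za; have := stuck a; rewrite za /=; lia.
have : \sum_v (\sum_(a in arcs_out v) z a + (v == r) * SOL_obj r z)
         <= \sum_v \sum_(a in arcs_in v) z a by apply: leq_sum.
rewrite big_split /= sum_arcs_out sum_arcs_in (bigD1 r) //= eqxx mul1n.
lia.
Qed.

Lemma SOL_feasible_solvable (G : graph) (r : G) (p : config G)
    (z : arc_vars G) :
  SOL_feasible p r z -> 0 < SOL_obj r z -> solvable r p.
Proof.
(* Induction on the total flow, which each executed move lowers by one. *)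
have [n] := ubnP (\sum_(a in setT) z a); elim: n => // n IHn in p z *.
move=> le_zn fz z_gt0; have [a za pa] := SOL_feasible_executable fz z_gt0.
have ar : arc_tail a != r.
  apply: contraTneq za => ar; rewrite -leqNgt; apply: leq_trans fz.2.
  by rewrite (bigD1 a) ?inE ?ar //= leq_addr.
pose z' : arc_vars G := [ffun b => z b - (b == a)].
have def_z : z = add_arc z' a.
  apply/ffunP=> b; rewrite !ffunE.
  by case: eqP => [->|_]; rewrite ?subnK ?subn0 ?addn0.
apply: (solvable_step pa).
have [ha|ha] := eqVneq (arc_head a) r.
  by apply: solvable_ge1; rewrite ffunE ha eqxx addn1.
apply: (IHn _ z').
- by move: le_zn; rewrite {1}def_z sum_add_arc inE addn1.
- by apply/SOL_feasible_add_arc; rewrite -?def_z.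
- by move: z_gt0; rewrite def_z /SOL_obj sum_add_arc inE (negPf ha) addn0.
Qed.

(** Extra pebbles only relax the constraints of the integer program, so no move sequence has to be
    replayed. *)
Lemma leq_solvable (G : graph) (r : G) (p q : config G) :
  (forall v, p v <= q v) -> solvable r p -> solvable r q.
Proof.
move=> pq solp; have [pr0|pr_gt0] := posnP (p r).
  have [z fz] := solvable_SOL_feasible pr0 solp.
  exact/SOL_feasible_solvable/(leq_SOL_feasible pq).
exact/solvable_ge1/(leq_trans pr_gt0).
Qed.

(** Removing one pebble reduces size [m + 1] to size [m]. Hence the minimum defining
    [pebbling_number] is a threshold. *)
Lemma leq_all_solvable (G : graph) (S : {set G}) (r : G) (m n : nat) :
  m <= n -> all_solvable S r m -> all_solvable S r n.
Proof.
move=> /subnK <-; elim: (n - m) => //= k IHk /IHk {IHk}; rewrite addSn.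
move: (k + m) => {n k} {}m solm p sz_p sp.
have : 0 < config_size p by rewrite sz_p.
rewrite lt0n sum_nat_eq0 => /forallPn[v]; rewrite /= -lt0n => pv.
pose q : config G := [ffun u => p u - (u == v)].
have qp u : q u <= p u by rewrite ffunE leq_subr.
apply: (leq_solvable qp); apply: solm.
  have sz c : config_size c = c v + \sum_(u | u != v) c u by exact: bigD1.
  have q_p u : u != v -> q u = p u by move/negPf=> uv; rewrite ffunE uv subn0.
  by move: sz_p; rewrite !sz (eq_bigr p q_p) ffunE eqxx /=; lia.
apply: subset_trans sp; apply/subsetP => u; rewrite !inE => qu.
exact: leq_trans qu (qp u).
Qed.

Lemma pebbling_number_leP (G : graph) (S : {set G}) (r : G) (m : nat) :
  reflect (all_solvable S r m) (pebbling_number S r <= m).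
Proof.
rewrite /pebbling_number; case: ex_minnP => k /asboolP solk min_k.
apply: (iffP idP) => [le_km|solm]; first exact: leq_all_solvable solk.
by apply: min_k; apply/asboolP.
Qed.

Lemma config_of_val (G : graph) (S : {set G}) (y : supp_vars S) w :
  config_of y (val w) = y w.
Proof. by rewrite ffunE valK. Qed.

Lemma config_of_notin (G : graph) (S : {set G}) (y : supp_vars S) v :
  v \notin S -> config_of y v = 0.
Proof. by move=> vS; rewrite ffunE insubN. Qed.

Lemma config_supp_config_of (G : graph) (S : {set G}) (y : supp_vars S) :
  config_supp (config_of y) \subset S.
Proof.
by apply/subsetP => v; rewrite inE; apply: contraTT => /config_of_notin ->.
Qed.

Lemma config_size_config_of (G : graph) (S : {set G}) (y : supp_vars S) :
  config_size (config_of y) = PI_obj y.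
Proof.
rewrite /config_size (bigID (mem S)) /= addnC big1 => [|v /config_of_notin //].
rewrite add0n big_sub; apply: eq_bigr => w _; exact: config_of_val.
Qed.

Lemma config_of_surj (G : graph) (S : {set G}) (p : config G) :
  config_supp p \subset S -> exists y : supp_vars S, config_of y = p.
Proof.
move=> /subsetP sp; exists [ffun w => p (val w)]; apply/ffunP => v.
have [vS|vS] := boolP (v \in S).
  by rewrite -[v]/(val (Sub v vS : {v | v \in S})) config_of_val ffunE.
rewrite config_of_notin //; apply/esym/eqP; rewrite -leqn0 leqNgt.
by apply: contra vS => pv; apply: sp; rewrite inE.
Qed.

(** As [r] lies outside [S], it starts without pebbles, so an optimal follower value of 0 means
    unsolvability. *)
Lemma PI_feasibleP (G : graph) (S : {set G}) (r : G) (y : supp_vars S) :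
  r \notin S ->
  (exists x, PI_feasible r x y)
    <-> #|G| <= PI_obj y /\ ~ solvable r (config_of y).
Proof.
move=> rNS; split=> [[x [szy [_ xmax] x0]]|[szy unsol]].
  split=> // /(solvable_SOL_feasible (config_of_notin y rNS))[z /xmax le_zx].
  by apply/negP; rewrite -leqNgt; apply: leq_trans le_zx x0.
have sum0 (A : {set Defs.arc G}) : \sum_(a in A) [ffun=> 0] a = 0.
  by rewrite big1 // => a _; rewrite ffunE.
(* The zero flow is always feasible, and it is optimal when no flow has positive value. *)
exists [ffun=> 0]; split; rewrite ?sum0 //; split=> [|z fz].
  by split=> [v|]; rewrite -?big_distrr /= sum0.
rewrite leqNgt; apply/negP => z_gt0; apply: unsol.
by apply: (SOL_feasible_solvable fz); apply: leq_ltn_trans z_gt0.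
Qed.

Lemma all_solvable_vars (G : graph) (S : {set G}) (r : G) (m : nat) :
  all_solvable S r m
    <-> forall y : supp_vars S, PI_obj y = m -> solvable r (config_of y).
Proof.
split=> sol => [y szy|p sz_p /config_of_surj[y def_p]].
  by apply: sol; rewrite ?config_size_config_of ?config_supp_config_of.
by rewrite -def_p; apply: sol; rewrite -config_size_config_of def_p.
Qed.

Theorem theorem3 (G : graph) (S : {set G}) (r : G) (rNS : r \notin S) :
  (PI_infeasible S r -> pebbling_number S r <= #|G|) /\
  (~ PI_infeasible S r -> PI_optimal_value S r (pebbling_number S r - 1)).
Proof.
split=> [infeas|/contrapT[x0 [y0 fxy0]]].
  apply/pebbling_number_leP/all_solvable_vars => y szy.
  apply: contrapT => unsol; apply: infeas.
  have [x fx] : exists x, PI_feasible r x y.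
    by apply/PI_feasibleP; rewrite ?szy.
  by exists x, y.
have pi_gt0 := pebbling_number_gt0 S r.
have le_pi x y : @PI_feasible G S r x y -> PI_obj y <= pebbling_number S r - 1.
  move=> fxy; have [_ unsol] : #|G| <= PI_obj y /\ ~ solvable r (config_of y).
    by apply/PI_feasibleP => //; exists x.
  rewrite leq_subRL // add1n ltnNge; apply/pebbling_number_leP => sol.
  exact/unsol/(all_solvable_vars S r (PI_obj y)).1.
split=> //.
(* Minimality yields an unsolvable configuration with one pebble fewer than the pebbling number,
   which attains the bound. *)
have : ~ all_solvable S r (pebbling_number S r - 1).
  by move/pebbling_number_leP; lia.
rewrite all_solvable_vars => /existsNP[y /not_implyP[szy unsol]].
have [x fx] : exists x, PI_feasible r x y.
  apply/PI_feasibleP => //; split=> //; rewrite szy.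
  (* The given feasible pair supplies the size constraint [#|G| <= pebbling_number S r - 1]. *)
  by apply: leq_trans (le_pi _ _ fxy0); case: fxy0.
by exists x, y.
Qed.
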